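(* Let $f:\mathbb{R}^N\to\mathbb{R}$ be strictly convex, self-concordant with constant $2$ and bounded below so that a minimizer $x^*$ exists. Suppose that the operators $R_k$ are random sampling operators (columns of the identity drawn without replacement according to a discrete probability distribution) and that the sequence $(x_k)_{k\in\mathbb{N}}$ is generated by the algorithm SIGMA. Suppose also that $\hat\lambda(x_k)>\nu$ while $x_k\ne x^*$. Then there exists $\tilde\gamma>0$ such that, at each such iteration, $$\mathbb{E}\left[f(x_{k+1})-f(x_k)\right]\le-\tilde\gamma.$$
   Context: Self-concordance with constant $2$: $f$ is three times differentiable, convex, and for all $x,u\in\mathbb{R}^N$ the function $\phi(t)=f(x+tu)$ satisfies $|\phi'''(t)|\le 2\phi''(t)^{3/2}$. Strict convexity is used in the sense that $\nabla^2f(x)$ is positive definite. Random operators: let $n<N$, $S_N=\{1,\dots,N\}$. At each iteration $k$ a subset $S_n\subset S_N$ of $n$ elements is randomly selected from $S_N$ without replacement according to a discrete probability distribution. If $s_i$ is the $i$-th element of $S_n$, then the $i$-th column of $P_k\in\mathbb{R}^{N\times n}$ is the $s_i$-th column of the $N\times N$ identity matrix, and $R_k=P_k^T$. The expectation $\mathbb{E}$ is with respect to the randomness of this sampling. Coarse direction: $\hat d_k:=-P_k[R_k\nabla^2f(x_k)P_k]^{-1}R_k\nabla f(x_k)$. Approximate decrement: $\hat\lambda(x_k):=\left[(R_k\nabla f(x_k))^T[R_k\nabla^2f(x_k)P_k]^{-1}R_k\nabla f(x_k)\right]^{1/2}$. Algorithm SIGMA in this setting: inputs $\alpha\in(0,0.5)$,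 $\beta\in(0,1)$, $\nu\in(0,0.68^2)$, tolerance $\epsilon\in(\nu,0.68^2)$ and $x_0\in\mathbb{R}^N$; the direction at iteration $k$ is the coarse direction $\hat d_k$. Stop if $-\langle\nabla f(x_k),\hat d_k\rangle\le\epsilon$. Otherwise determine $t_k$ by backtracking: start from $t_k=1$ and, while $f(x_k+t_k\hat d_k)>f(x_k)+\alpha t_k\nabla f(x_k)^T\hat d_k$, replace $t_k$ by $\beta t_k$. Set $x_{k+1}=x_k+t_k\hat d_k$. *)

(* Defs.v *)
From mathcomp Require Import all_boot all_order all_algebra.
From mathcomp Require Import all_classical all_reals all_analysis.
Import Order.TTheory GRing.Theory Num.Theory.
Import numFieldNormedType.Exports.

Set Implicit Arguments.
Unset Strict Implicit.
Unset Printing Implicit Defensive.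

Local Open Scope classical_set_scope.
Local Open Scope ring_scope.

Section Calculus.
Context {R : realType} {N : nat}.
Implicit Types (f : 'cV[R]_N -> R) (x u v : 'cV[R]_N).

Definition dotp (m : nat) (u v : 'cV[R]_m) : R := (u^T *m v) 0 0.

Definition gradient f x : 'cV[R]_N := \col_i 'D_(delta_mx i 0) f x.

Definition hessian f x : 'M[R]_N :=
  \matrix_(i, j) 'D_(delta_mx j 0) (fun y => gradient f y i 0) x.

Definition thrice_differentiable f :=
  forall x, [/\ differentiable f x, differentiable (gradient f) x
              & differentiable (hessian f) x].

(* Self-concordance with constant 2. *)
Definition self_concordant f :=
  [/\ thrice_differentiable f,
      convex_function [set: convex_lmodType 'cV[R]_N] f
    & forall x u (t : R), let phi := fun s : R => f (x + s *: u) in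
        `| derive1n 3 phi t | <= 2 * derive1n 2 phi t `^ (3 / 2)].

(* Symmetry is not required here: it is automatic for the Hessian of a
   function whose gradient is differentiable. *)
Definition posdef (A : 'M[R]_N) := forall u, u != 0 -> 0 < dotp u (A *m u).

End Calculus.

Section Sampling.
Context {R : realType} {N : nat}.

(* A law for the n-element subset drawn at each iteration. *)
Definition sampling_law (n : nat) (p : {set 'I_N} -> R) :=
  [/\ forall S, 0 <= p S,
      \sum_S p S = 1
    & forall S, p S != 0 -> #|S| = n].

Definition prob (p : {set 'I_N} -> R) (A : pred {set 'I_N}) : R :=
  \sum_(S | A S) p S.

Definition cond_expectation (p : {set 'I_N} -> R) (A : pred {set 'I_N})
    (F : {set 'I_N} -> R) : R :=
  (\sum_(S | A S) p S * F S) / prob p A.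

(* The i-th column is the s_i-th column of the identity, with s_i the i-th
   element of S; the width #|S| is n for every S charged by the law. *)
Definition prolongation (S : {set 'I_N}) : 'M[R]_(N, #|S|) :=
  colsub (fun i : 'I_#|S| => enum_val i) 1%:M.

Definition restriction (S : {set 'I_N}) : 'M[R]_(#|S|, N) :=
  (prolongation S)^T.

End Sampling.

Section Sigma.
Context {R : realType} {N : nat}.
Variables (f : 'cV[R]_N -> R) (alpha beta eps : R).
Implicit Types (x y : 'cV[R]_N) (S : {set 'I_N}) (p : {set 'I_N} -> R).

Definition reduced_gradient S x : 'cV[R]_#|S| :=
  restriction S *m gradient f x.

Definition reduced_hessian S x : 'M[R]_#|S| :=
  restriction S *m hessian f x *m prolongation S.

Definition coarse_direction S x : 'cV[R]_N :=
  - (prolongation S *m (invmx (reduced_hessian S x) *m reduced_gradient S x)).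

Definition approx_decrement S x : R :=
  Num.sqrt (dotp (reduced_gradient S x)
                 (invmx (reduced_hessian S x) *m reduced_gradient S x)).

Definition stops S x : bool :=
  - dotp (gradient f x) (coarse_direction S x) <= eps.

Definition backtracks S x (t : R) : bool :=
  let d := coarse_direction S x in
  f (x + t *: d) > f x + alpha * t * dotp (gradient f x) d.

Definition sigma_update S x y :=
  exists m : nat,
    [/\ forall i, (i < m)%N -> backtracks S x (beta ^+ i),
        ~~ backtracks S x (beta ^+ m)
      & y = x + beta ^+ m *: coarse_direction S x].

(* The random iterates are encoded as a function X of the history of the
   samples: X [:: S_0; ...; S_(k-1)] is the value of x_k when the first k
   subsets drawn are S_0, ..., S_(k-1). A history is reachable when all its
   subsets have positive probability and no stopping test succeeded. *)
Inductive reachable p (X : seq {set 'I_N} -> 'cV[R]_N) :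
    seq {set 'I_N} -> Prop :=
| reachable_nil : reachable p X [::]
| reachable_rcons h S : reachable p X h -> 0 < p S -> ~~ stops S (X h) ->
    reachable p X (rcons h S).

Definition sigma_iterates p (x0 : 'cV[R]_N) (X : seq {set 'I_N} -> 'cV[R]_N) :=
  X [::] = x0 /\
  forall h S, reachable p X (rcons h S) ->
    sigma_update S (X h) (X (rcons h S)).

(* Subsets for which the iteration started at x does produce a next iterate. *)
Definition performed x : pred {set 'I_N} := fun S => ~~ stops S x.

End Sigma.

(* Main.v *)
(** Write [lam^2 = - <gradient f x, d>] for the coarse direction [d]; it equals
    [<d, hessian f x d>], so [phi t = f (x + t d)] has [phi' 0 = - lam^2] and
    [phi'' 0 = lam^2].  By self-concordance [phi''^(-1/2)] is 1-Lipschitz, hence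
    [phi'' <= 4 lam^2] on [[0, 1 / (2 lam)]], and the mean value theorem, applied
    twice, gives [phi s <= phi 0 - s lam^2 + 4 s^2 lam^2] there.  As
    [alpha < 1 / 2], every step [s <= min (1 / 8, 1 / (2 lam))] is accepted, so
    the backtracking step is at least [beta] times this minimum.  When the
    stopping test fails, [lam^2 > eps] with [eps < 1], so each performed update
    decreases [f] by at least [alpha beta eps / 8], and so does their mean. *)

Require Import Defs.
From mathcomp Require Import all_boot all_order all_algebra.
From mathcomp Require Import all_classical all_reals all_analysis.
From mathcomp Require Import ring lra.
Import Order.TTheory GRing.Theory Num.Theory.
Import numFieldNormedType.Exports.

Set Implicit Arguments.
Unset Strict Implicit.
Unset Printing Implicit Defensive.

Local Open Scope ring_scope.

(** * Self-concordant functions of one real variable *)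

Lemma mean_value (R : realType) (F dF : R -> R) (s : R) :
  0 <= s -> (forall t, is_derive t (1 : R) F (dF t)) ->
  exists2 c, 0 <= c <= s & F s = F 0 + s * dF c.
Proof.
move=> s0 dF1.
have [|c /itvP cI E] := MVT_segment s0 (fun t _ => dF1 t).
  by apply: derivable_within_continuous => t _; have [] := dF1 t.
by exists c; [rewrite !cI|rewrite mulrC -[s in _ * s]subr0 -E addrC subrK].
Qed.

(* The self-concordance inequality says that [phi''^(-1/2)] is 1-Lipschitz. *)
Lemma second_derivative_growth (R : realType) (phi2 phi3 : R -> R) (s : R) :
  (forall t, is_derive t (1 : R) phi2 (phi3 t)) -> (forall t, 0 < phi2 t) ->
  (forall t, `|phi3 t| <= 2 * phi2 t `^ (3 / 2)) ->
  0 <= s -> 2 * (s * Num.sqrt (phi2 0)) <= 1 -> phi2 s <= 4 * phi2 0.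
Proof.
move=> d3 pos sc s0 small.
pose g := (fun y => y `^ (- (1 / 2))) \o phi2.
pose dg t := (- (1 / 2) * phi2 t `^ (- (1 / 2) - 1)) * phi3 t.
have [|c _ gs] := @mean_value _ g dg s s0.
  by move=> t; apply: is_derive1_comp; exact: is_derive1_powR.
(* Here [dg] is [- phi2^(-3/2) * phi3 / 2], so the bound on [phi3] cancels both the power and the
   factor 2. An upper bound on [phi2] only requires that [g] not fall too fast. *)
have dg_ge : -1 <= dg c.
  have /ler_normlP[_ +] : `|- dg c| <= 1; last by lra.
  rewrite normrN /dg 2!normrM normrN (ger0_norm (powR_ge0 _ _)).
  rewrite (@ger0_norm _ (1 / 2)) ?divr_ge0//.
  apply: (@le_trans _ _ (1 / 2 * phi2 c `^ (- (1 / 2) - 1) *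
                         (2 * phi2 c `^ (3 / 2)))).
    by rewrite ler_wpM2l ?mulr_ge0 ?divr_ge0 ?powR_ge0.
  rewrite mulrACA -powRD; last by rewrite (gt_eqF (pos c)) implybT.
  by rewrite (_ : - (1 / 2) - 1 + 3 / 2 = 0) ?powRr0; lra.
have gE t : g t = (Num.sqrt (phi2 t))^-1.
  by rewrite /g /= powRN mul1r powR12_sqrt// ltW.
have q0 : 0 < Num.sqrt (phi2 0) by rewrite sqrtr_gt0.
have qs : 0 < Num.sqrt (phi2 s) by rewrite sqrtr_gt0.
rewrite !gE in gs.
(* By [small], [s] is at most half of [g 0], so [g s >= g 0 - s >= g 0 / 2]; inverting and squaring
   gives the factor 4. *)
have sle : 2 * s <= (Num.sqrt (phi2 0))^-1.
  by rewrite -[_^-1]mul1r ler_pdivlMr// -mulrA.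
have sdg : - s <= s * dg c by rewrite -mulrN1 ler_wpM2l.
have : (2 * Num.sqrt (phi2 0))^-1 <= (Num.sqrt (phi2 s))^-1.
  by rewrite invfM gs; lra.
rewrite lef_pV2 ?posrE ?mulr_gt0// => qq.
rewrite -(sqr_sqrtr (ltW (pos s))) -(sqr_sqrtr (ltW (pos 0))).
rewrite (_ : 4 * _ = (2 * Num.sqrt (phi2 0)) ^+ 2); last by ring.
by rewrite lerXn2r ?nnegrE// ltW// mulr_gt0.
Qed.

(** Two mean values give [phi s = phi 0 + s * (phi1 0 + c * phi2 b)] with [b <= c <= s], and the
    growth bound applies at [b]. Bounding [c] by [s] yields the coefficient 4, where a Taylor
    remainder would give 2. *)
Lemma self_concordant_upper_bound (R : realType) (phi phi1 phi2 phi3 : R -> R)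
    (s : R) :
  (forall t, is_derive t (1 : R) phi (phi1 t)) ->
  (forall t, is_derive t (1 : R) phi1 (phi2 t)) ->
  (forall t, is_derive t (1 : R) phi2 (phi3 t)) -> (forall t, 0 < phi2 t) ->
  (forall t, `|phi3 t| <= 2 * phi2 t `^ (3 / 2)) ->
  0 <= s -> 2 * (s * Num.sqrt (phi2 0)) <= 1 ->
  phi s <= phi 0 + s * phi1 0 + 4 * s ^+ 2 * phi2 0.
Proof.
move=> d1 d2 d3 pos sc s0 small.
have [c /andP[c0 cs] ->] := mean_value s0 d1.
have [b /andP[b0 bc] ->] := mean_value c0 d2.
have b_small : 2 * (b * Num.sqrt (phi2 0)) <= 1.
  apply: le_trans small; rewrite ler_pM2l// ler_wpM2r ?sqrtr_ge0//.
  exact: le_trans cs.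
have H := second_derivative_growth d3 pos sc b0 b_small.
rewrite -addrA lerD2l mulrDr lerD2l expr2.
have : c * phi2 b <= s * (4 * phi2 0) by rewrite ler_pM// ltW.
by move/(ler_wpM2l s0) => /le_trans; apply; rewrite le_eqVlt; apply/orP; left;
  apply/eqP; ring.
Qed.

(** * Inner products and derivatives along a line *)

Lemma dotpE (R : realType) (m : nat) (u v : 'cV[R]_m) :
  dotp u v = \sum_i u i 0 * v i 0.
Proof. by rewrite /dotp mxE; apply: eq_bigr => i _; rewrite mxE. Qed.

Lemma dotpC (R : realType) (m : nat) (u v : 'cV[R]_m) : dotp u v = dotp v u.
Proof. by rewrite !dotpE; apply: eq_bigr => i _; rewrite mulrC. Qed.

Section Lines.
Context {R : realType} {N : nat}.
Implicit Types (f : 'cV[R]_N -> R) (x u : 'cV[R]_N).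

Lemma is_derive_line f x u (s : R) : differentiable f (x + s *: u) ->
  is_derive s (1 : R) (fun t : R => f (x + t *: u)) ('D_u f (x + s *: u)).
Proof.
(* The difference quotient of the restriction at [s] is the directional quotient of [f] at
   [x + s *: u], so both limits agree. *)
have E : (fun h : R => h^-1 *: (((fun t : R => f (x + t *: u)) \o shift s) (h *: 1)
       - f (x + s *: u))) =
   (fun h : R => h^-1 *: ((f \o shift (x + s *: u)) (h *: u) - f (x + s *: u))).
  apply/funext => h /=; congr (_ *: (f _ - _)).
  by rewrite (mulr1 h : h *: (1 : R) = h) scalerDl addrCA.
move=> df; have := @diff_derivable _ _ _ f _ u df.
by rewrite /derivable -E => D; apply: DeriveDef => //; rewrite /derive E.
Qed.

Lemma derive_gradient f x u : differentiable f x ->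
  'D_u f x = dotp (gradient f x) u.
Proof.
move=> df; rewrite deriveE// {1}[u]matrix_sum_delta linear_sum dotpE.
apply: eq_bigr => i _; rewrite big_ord1 linearZ mxE deriveE//=.
by rewrite /GRing.scale /= mulrC.
Qed.

Lemma differentiable_entry m k (F : 'cV[R]_N -> 'M[R]_(m, k)) x i j :
  differentiable F x -> differentiable (fun y => F y i j) x.
Proof.
move=> dF; apply: (@differentiable_comp _ _ _ _ F (fun M => M i j)) => //.
exact: differentiable_coord.
Qed.

Variables (f : 'cV[R]_N -> R) (x u : 'cV[R]_N).
Hypothesis f3 : thrice_differentiable f.

Lemma is_derive_line1 (t : R) : is_derive t (1 : R) (fun s : R => f (x + s *: u))
  (dotp (gradient f (x + t *: u)) u).
Proof.
have [df _ _] := f3 (x + t *: u).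
by rewrite -derive_gradient//; exact: is_derive_line.
Qed.

Lemma is_derive_line2 (t : R) :
  is_derive t (1 : R) (fun s : R => dotp (gradient f (x + s *: u)) u)
    (dotp u (hessian f (x + t *: u) *m u)).
Proof.
have [_ dg _] := f3 (x + t *: u).
rewrite (_ : (fun s : R => _) =
  \sum_i (u i 0 \*: fun s : R => gradient f (x + s *: u) i 0)); last first.
  apply/funext => s; rewrite dotpC dotpE fct_sumE.
  by apply: eq_bigr => i _.
rewrite dotpE; apply: is_derive_sum => i; apply: is_deriveZ.
have dgi : differentiable (fun y => gradient f y i 0) (x + t *: u).
  exact: differentiable_entry.
apply: is_derive_eq; first exact: (is_derive_line dgi).
rewrite derive_gradient// dotpE mxE.
by apply: eq_bigr => j _; rewrite !mxE.
Qed.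

Lemma derivable_line2 (t : R) :
  derivable (fun s : R => dotp u (hessian f (x + s *: u) *m u)) t (1 : R).
Proof.
have [_ _ dh] := f3 (x + t *: u).
rewrite (_ : (fun s : R => _) =
  \sum_i (u i 0 \*: \sum_j
    (u j 0 \*: fun s : R => hessian f (x + s *: u) i j))); last first.
  apply/funext => s; rewrite dotpE fct_sumE.
  apply: eq_bigr => i _; rewrite /= mxE fct_sumE; congr (_ * _).
  by apply: eq_bigr => j _; rewrite mulrC.
apply: derivable_sum => i; apply: derivableZ; apply: derivable_sum => j.
apply: derivableZ; have [] // := @is_derive_line (fun y => hessian f y i j) x u t.
exact: differentiable_entry.
Qed.

End Lines.

Lemma self_concordant_descent (R : realType) (N : nat) (f : 'cV[R]_N -> R)
    (x u : 'cV[R]_N) (s : R) :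
  self_concordant f -> (forall y, posdef (hessian f y)) -> u != 0 -> 0 <= s ->
  2 * (s * Num.sqrt (dotp u (hessian f x *m u))) <= 1 ->
  f (x + s *: u) <= f x + s * dotp (gradient f x) u
                    + 4 * s ^+ 2 * dotp u (hessian f x *m u).
Proof.
move=> [f3 _ sc] pd u0 s0.
pose phi t : R := f (x + t *: u).
pose phi1 t : R := dotp (gradient f (x + t *: u)) u.
pose phi2 t : R := dotp u (hessian f (x + t *: u) *m u).
have d1 t : is_derive t (1 : R) phi (phi1 t) by exact: is_derive_line1.
have d2 t : is_derive t (1 : R) phi1 (phi2 t) by exact: is_derive_line2.
have d3 t : is_derive t (1 : R) phi2 (derive1 phi2 t).
  by rewrite derive1E; apply: DeriveDef => //; exact: derivable_line2.
(* These identities turn the iterated derivatives [derive1n] of the self-concordance inequality into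
   [phi2] and its derivative. *)
have e1 : derive1 phi = phi1.
  by apply/funext => t; rewrite derive1E; have [] := d1 t.
have e2 : derive1 phi1 = phi2.
  by apply/funext => t; rewrite derive1E; have [] := d2 t.
have sc2 t : `|derive1 phi2 t| <= 2 * phi2 t `^ (3 / 2).
  by rewrite -e2 -e1; exact: sc x u t.
have pos t : 0 < phi2 t by exact: pd.
have := self_concordant_upper_bound d1 d2 d3 pos sc2 s0.
by rewrite /phi /phi1 /phi2 scale0r addr0.
Qed.

(** * The reduced Newton system *)

Section CoarseDirection.
Context {R : realType} {N : nat}.
Variables (f : 'cV[R]_N -> R) (S : {set 'I_N}) (x : 'cV[R]_N).
Hypothesis pd : posdef (hessian f x).

Lemma restriction_prolongation :
  restriction S *m prolongation S = 1%:M :> 'M[R]_#|S|.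
Proof.
apply/matrixP => i j; rewrite !mxE (bigD1 (enum_val i)) //= big1.
  by rewrite !mxE eqxx mul1r addr0 (inj_eq enum_val_inj).
by move=> k ki; rewrite !mxE (negPf ki) mul0r.
Qed.

Lemma dotp_prolongation (z : 'cV[R]_#|S|) (v : 'cV[R]_N) :
  dotp (prolongation S *m z) v = dotp z (restriction S *m v).
Proof. by rewrite /dotp trmx_mul mulmxA. Qed.

(** A kernel vector [z] prolongs to [P z] with [<P z, H (P z)> = 0], so [P z = 0] by positive
    definiteness, and [z = R (P z) = 0]. The transposes are there because [kermx] is a left
    kernel. *)
Lemma reduced_hessian_unit : reduced_hessian f S x \in unitmx.
Proof.
rewrite -unitmx_tr -row_free_unit -kermx_eq0; apply/rowV0P => v.
rewrite sub_kermx -[v]trmxK -trmx_mul trmx_eq0 => /eqP Hv.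
have [|nz] := eqVneq (prolongation S *m v^T) 0.
  move=> /(congr1 (mulmx (restriction S))).
  by rewrite mulmxA restriction_prolongation mul1mx mulmx0 => ->; rewrite trmx0.
have := pd nz; rewrite dotp_prolongation !mulmxA -/(reduced_hessian f S x).
by rewrite Hv /dotp mulmx0 mxE ltxx.
Qed.

Lemma dotp_coarse_direction : let d := coarse_direction f S x in
  dotp d (hessian f x *m d) = - dotp (gradient f x) d.
Proof.
rewrite /coarse_direction /= -mulmxN (dotpC (gradient f x)).
rewrite !dotp_prolongation !mulmxA -/(reduced_hessian f S x) mulmxN.
rewrite !mulmxA mulmxV ?reduced_hessian_unit// mul1mx.
by rewrite /dotp mulmxN mxE.
Qed.

End CoarseDirection.

(** * Backtracking and the decrease per update *)

Section Step.
Context {R : realType} {N : nat}.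
Variables (f : 'cV[R]_N -> R) (alpha beta eps : R).
Hypotheses (f_sc : self_concordant f) (f_pd : forall x, posdef (hessian f x)).
Hypotheses (alpha_itv : 0 < alpha < 1 / 2) (beta_itv : 0 < beta < 1).
Variables (S : {set 'I_N}) (x : 'cV[R]_N).
Let d := coarse_direction f S x.
Let lam2 : R := - dotp (gradient f x) d.

Lemma backtracks_step (s : R) : 0 < lam2 -> 0 <= s ->
  backtracks f alpha S x s -> 1 < 8 * s \/ 1 < 2 * (s * Num.sqrt lam2).
Proof.
move=> lam2_gt0 s0; rewrite /backtracks -/d => bt.
have dHd : dotp d (hessian f x *m d) = lam2 by exact: dotp_coarse_direction.
have d_neq0 : d != 0.
  by apply: contraTneq lam2_gt0 => d0; rewrite -dHd d0 /dotp !mulmx0 mxE ltxx.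
have [s8|] := leP (8 * s) 1; last by left.
have [small|] := leP (2 * (s * Num.sqrt lam2)) 1; last by right.
have := @self_concordant_descent R N f x d s f_sc f_pd d_neq0 s0.
rewrite dHd => /(_ small) /(lt_le_trans bt).
rewrite -[dotp _ _]opprK -/lam2.
case/andP: alpha_itv => a0 a1.
(* The quadratic bound implies the acceptance test once [4 * s <= 1 - alpha], which follows from
   [8 * s <= 1] and [alpha < 1 / 2]. *)
suff : 4 * s ^+ 2 * lam2 <= s * lam2 * (1 - alpha) by lra.
rewrite (_ : 4 * _ * _ = s * lam2 * (4 * s)); last by ring.
by rewrite ler_wpM2l ?mulr_ge0 ?(ltW lam2_gt0)//; lra.
Qed.

Lemma sigma_update_decrease (y : 'cV[R]_N) : 0 < eps < 1 ->
  performed f eps x S -> sigma_update f alpha beta S x y ->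
  f y - f x <= - (alpha * beta * eps / 8).
Proof.
move=> /andP[e0 e1]; rewrite /performed /stops -/d -/lam2 -ltNge => lam2_gt.
have lam2_gt0 : 0 < lam2 by exact: lt_trans lam2_gt.
case/andP: alpha_itv => a0 a1; case/andP: beta_itv => b0 b1.
move=> [m [bt nbt ->]].
set t := beta ^+ m in nbt *.
suff tl : beta * eps / 8 <= t * lam2.
  move: nbt; rewrite /backtracks -/d -leNgt -[dotp _ _]opprK -/lam2 => nbt.
  have := ler_wpM2l (ltW a0) tl; lra.
(* Either the full step 1 is accepted, or the previous trial [beta ^+ m] was rejected and exceeds
   one of the two thresholds. *)
case: m @t nbt bt => [|m] t _ bt.
  rewrite /t expr0 mul1r; apply: le_trans (ltW lam2_gt).
  have := ler_wpM2r (ltW e0) (ltW b1); have := mulr_gt0 b0 e0; lra.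
rewrite /t exprS -!mulrA ler_pM2l//.
have s0 : 0 < beta ^+ m by exact: exprn_gt0.
have [s8|sl] := backtracks_step lam2_gt0 (ltW s0) (bt m (ltnSn m)).
  have : 1 * lam2 < 8 * beta ^+ m * lam2 by rewrite ltr_pM2r.
  lra.
have q0 : 0 < Num.sqrt lam2 by rewrite sqrtr_gt0.
have : 1 * Num.sqrt lam2 < 2 * (beta ^+ m * Num.sqrt lam2) * Num.sqrt lam2.
  by rewrite ltr_pM2r.
rewrite -!mulrA -expr2 sqr_sqrtr ?(ltW lam2_gt0)// => H.
(* [H] bounds [beta ^+ m * lam2] below by half of [Num.sqrt lam2]. Since [eps < 1],
   [eps ^+ 2 <= eps < lam2], which makes the bound uniform. *)
have : eps <= Num.sqrt lam2.
  rewrite -(ger0_norm (ltW e0)) -sqrtr_sqr ler_sqrt ?(ltW lam2_gt0)//.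
  apply: le_trans (ltW lam2_gt); rewrite expr2.
  by have := ler_wpM2l (ltW e0) (ltW e1); rewrite mulr1.
lra.
Qed.

End Step.

Theorem theorem3p4 (R : realType) (N n : nat) (n_lt_N : (n < N)%N)
  (f : 'cV[R]_N -> R)
  (f_strict : forall x, posdef (hessian f x))
  (f_sc : self_concordant f)
  (f_bounded : exists b : R, forall x, b <= f x)
  (xs : 'cV[R]_N) (xs_min : forall x, f xs <= f x)
  (alpha beta nu eps : R)
  (alpha_itv : 0 < alpha < 1 / 2)
  (beta_itv : 0 < beta < 1)
  (nu_itv : 0 < nu < (68 / 100) ^+ 2)
  (eps_itv : nu < eps < (68 / 100) ^+ 2)
  (p : {set 'I_N} -> R) (p_law : sampling_law n p)
  (x0 : 'cV[R]_N) (X : seq {set 'I_N} -> 'cV[R]_N)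
  (X_sigma : sigma_iterates f alpha beta eps p x0 X)
  (decrement_gt : forall h S, reachable f eps p X h -> X h != xs -> 0 < p S ->
     nu < approx_decrement f S (X h)) :
  exists2 gamma : R, 0 < gamma &
    forall h, reachable f eps p X h -> X h != xs ->
      0 < prob p (performed f eps (X h)) ->
      cond_expectation p (performed f eps (X h))
        (fun S => f (X (rcons h S)) - f (X h)) <= - gamma.
Proof.
have eps01 : 0 < eps < 1.
  case/andP: nu_itv => nu0 _; case/andP: eps_itv => e0 e1.
  by rewrite (lt_trans nu0 e0)/=; apply: lt_trans e1 _; rewrite expr2; lra.
have [p_ge0 _ _] := p_law; have [_ X_step] := X_sigma.
exists (alpha * beta * eps / 8).
  case/andP: alpha_itv => a0 _; case/andP: beta_itv => b0 _.
  by case/andP: eps01 => e0 _; rewrite divr_gt0 ?mulr_gt0.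
(* Clearing the denominator leaves a termwise comparison of two sums over the performed subsets. *)
move=> h h_reach _ prob_gt0; rewrite /cond_expectation ler_pdivrMr//.
rewrite /prob mulr_sumr; apply: ler_sum => S perf; rewrite mulrC.
(* [X (rcons h S)] is constrained only when [p S > 0]; otherwise both terms vanish. *)
have [->|p_neq0] := eqVneq (p S) 0; first by rewrite !mulr0.
have p_gt0 : 0 < p S by rewrite lt_neqAle eq_sym p_neq0 p_ge0.
rewrite ler_pM2r//; apply: (@sigma_update_decrease _ _ f _ beta _ _ _ _ _ S) => //.
by apply: X_step; apply: reachable_rcons.
Qed.
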